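(* Let $0<\sigma<N$, $m>-1$, and suppose that $g\ge0$ satisfies, for some $c_0>0$ and $R_0\ge1$, $$\int_{|y|\le R}g(y,t)\,dy\ \ge\ c_0\,t^m\qquad\text{for all }t\ge1,\ R\ge R_0.$$ Let $$\mathbf{w}(x,t):=(I_\sigma g(\cdot,t))(x)=c_{N,\sigma}\int_{\mathbb{R}^N}\frac{g(y,t)}{|x-y|^{N-\sigma}}\,dy.$$ Then there is a constant $c>0$ such that, for all $T\ge\max(1,R_0^2)$ and $t\ge1$, $$\int_{|x|\le\sqrt T}\mathbf{w}(x,t)\,dx\ \ge\ c\,T^{\sigma/2}\,t^m,$$ and consequently the problem $$\partial_tu-\Delta u=|u|^p+\mathbf{w}(x,t)\ \text{ in }(0,\infty)\times\mathbb{R}^N,\qquad u(0,\cdot)=u_0,$$ admits no global weak solution for $$1<p<\frac{N+\sigma-2m}{N+\sigma-2m-2}\qquad(\text{for all }p>1\text{ if }N+\sigma-2m\le2).$$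
   Context: $I_\sigma$ is the Riesz potential on $\mathbb{R}^N$, with normalizing constant $c_{N,\sigma}>0$; $g$ is a nonnegative measurable function on $\mathbb{R}^N\times[0,\infty)$. As always for this problem, the forcing satisfies $\mathbf{w}\in L^1_{\mathrm{loc}}([0,\infty)\times\mathbb{R}^N)$. Global weak solution: let $p>1$, $u_0\in L^1_{\mathrm{loc}}(\mathbb{R}^N)$, $u_0\ge0$, $\mathbf{w}\in L^1_{\mathrm{loc}}([0,\infty)\times\mathbb{R}^N)$. A global weak solution of the problem is a function $u\in L^p_{\mathrm{loc}}([0,\infty)\times\mathbb{R}^N)$, $u\ge0$ a.e., such that $$\int_0^T\!\!\int_{\mathbb{R}^N}(|u|^p+\mathbf{w})\varphi\,dx\,dt+\int_{\mathbb{R}^N}u_0\,\varphi(0,x)\,dx=-\int_0^T\!\!\int_{\mathbb{R}^N}u\,\partial_t\varphi\,dx\,dt-\int_0^T\!\!\int_{\mathbb{R}^N}u\,\Delta\varphi\,dx\,dt$$ for every $T>0$ and every nonnegative $\varphi\in C^{1,2}([0,T]\times\mathbb{R}^N)$ (once continuously differentiable in time, twice in space) which is compactly supported in space and satisfies $\varphi(T,\cdot)\equiv0$. ''Admits no global weak solution'' means that none exists for any such $u_0$. *)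

(* Defs.v *)
From HB Require Import structures.
From mathcomp Require Import all_boot all_order all_algebra.
From mathcomp Require Import all_classical all_reals all_analysis.
From mathcomp Require Import measurable_realfun.

Set Implicit Arguments.
Unset Strict Implicit.
Unset Printing Implicit Defensive.

Import Order.TTheory GRing.Theory Num.Theory.
Import numFieldNormedType.Exports.

Local Open Scope classical_set_scope.
Local Open Scope ring_scope.

(* Points of R^N are row vectors 'rV[R]_N, which already carry the product
   topology and a normed-module structure; as for tuples in MathComp-Analysis,
   the sigma-algebra is the one generated by the coordinate projections. *)
Definition rV_display : measure_display.
Proof. exact: default_measure_display. Qed.

Section measurable_rV.
Context {R : realType} (n : nat).

Let coor (i : 'I_n) (x : 'rV[R]_n) : measurableTypeR R := x 0 i.

Let rV_set0 : g_sigma_preimage coor set0.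
Proof. exact: sigma_algebra0. Qed.

Let rV_setC A : g_sigma_preimage coor A -> g_sigma_preimage coor (~` A).
Proof. exact: sigma_algebraC. Qed.

Let rV_bigcup (F : (set 'rV[R]_n)^nat) :
  (forall i, g_sigma_preimage coor (F i)) ->
  g_sigma_preimage coor (\bigcup_i (F i)).
Proof. exact: sigma_algebra_bigcup. Qed.

HB.instance Definition _ := @isMeasurable.Build rV_display
  'rV[R]_n (g_sigma_preimage coor) rV_set0 rV_setC rV_bigcup.

Lemma measurable_coord (i : 'I_n) :
  measurable_fun [set: 'rV[R]_n] (fun x => x 0 i : measurableTypeR R).
Proof.
move=> _ Y mY; rewrite setTI; apply: sub_sigma_algebra => /=.
rewrite -bigcup_seq/=; exists i => /=; first by rewrite mem_index_enum.
by exists Y => //; rewrite setTI.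
Qed.

Lemma measurable_fun_rVP d (T : measurableType d) (f : T -> 'rV[R]_n) :
  (forall i, measurable_fun [set: T] (fun t => f t 0 i : measurableTypeR R)) ->
  measurable_fun [set: T] f.
Proof.
move=> mf _ B mB; rewrite setTI.
pose H := [set B : set 'rV[R]_n | measurable (f @^-1` B)].
suff : g_sigma_preimage coor `<=` H by apply.
apply: smallest_sub.
  split=> [|A HA|F HF]; rewrite /H/=.
  - exact: measurable0.
  - rewrite setTD; exact: (measurableC HA).
  - by rewrite preimage_bigcup; apply: bigcupT_measurable => k; exact: HF.
rewrite -bigcup_seq; apply: bigcup_sub => i _ A [C mC <-].
by rewrite /H/= setTI -[X in measurable X]setTI; exact: (mf i).
Qed.

End measurable_rV.

Section lebesgue_step.
Context {R : realType} (n : nat).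
Variable mu : {sigma_finite_measure set 'rV[R]_n -> \bar R}.

Definition consrV (z : measurableTypeR R * 'rV[R]_n) : 'rV[R]_n.+1 :=
  row_mx (const_mx z.1 : 'rV[R]_1) z.2.

Lemma consrV0 z : consrV z 0 ord0 = z.1.
Proof.
have := row_mxEl (const_mx z.1 : 'rV[R]_1) z.2 0 ord0; rewrite [RHS]mxE => <-.
by congr (consrV z 0 _); exact/val_inj.
Qed.

Lemma consrVS z j : consrV z 0 (lift ord0 j) = z.2 0 j.
Proof.
have <- := row_mxEr (const_mx z.1 : 'rV[R]_1) z.2 0 j.
by congr (consrV z 0 _); exact/val_inj.
Qed.

Lemma measurable_consrV : measurable_fun setT consrV.
Proof.
apply: measurable_fun_rVP => i; have [j ->|->] := unliftP ord0 i.
- under eq_fun do rewrite consrVS.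
  exact: (measurableT_comp (measurable_coord j) measurable_snd).
- under eq_fun do rewrite consrV0.
  exact: measurable_fst.
Qed.

Definition lebesgue_step : set 'rV[R]_n.+1 -> \bar R :=
  pushforward (lebesgue_measure \x mu)%E consrV.

Let measurable_preimage A : measurable A -> measurable (consrV @^-1` A).
Proof. by move=> mA; rewrite -[X in measurable X]setTI; exact: measurable_consrV. Qed.

Let step0 : lebesgue_step set0 = 0%E.
Proof. by rewrite /lebesgue_step /pushforward preimage_set0 measure0. Qed.

Let step_ge0 A : (0 <= lebesgue_step A)%E.
Proof. by rewrite /lebesgue_step /pushforward; exact: measure_ge0. Qed.

Let step_sigma_additive : semi_sigma_additive lebesgue_step.
Proof.
move=> F mF tF mUF; rewrite /lebesgue_step /pushforward preimage_bigcup.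
apply: measure_semi_sigma_additive.
- by move=> k; exact: measurable_preimage.
- apply/trivIsetP => /= i j _ _ ij; rewrite -preimage_setI.
  by move/trivIsetP : tF => /(_ _ _ _ _ ij) ->//; rewrite preimage_set0.
- by rewrite -preimage_bigcup; exact: measurable_preimage.
Qed.

HB.instance Definition _ := isMeasure.Build _ _ _
  lebesgue_step step0 step_ge0 step_sigma_additive.

Let unconsrV (x : 'rV[R]_n.+1) : measurableTypeR R * 'rV[R]_n :=
  (x 0 ord0, \row_j x 0 (lift ord0 j)).

Let measurable_unconsrV : measurable_fun setT unconsrV.
Proof.
apply: measurable_fun_pair; first exact: measurable_coord.
apply: measurable_fun_rVP => j; under eq_fun do rewrite mxE.
exact: measurable_coord.
Qed.

Lemma lebesgue_stepE (A : set (measurableTypeR R)) (B : set 'rV[R]_n) :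
  measurable A -> measurable B ->
  lebesgue_step [set x | A (x 0 ord0) /\ B (\row_j x 0 (lift ord0 j))] =
  (lebesgue_measure A * mu B)%E.
Proof.
move=> mA mB; rewrite -product_measure1E// /lebesgue_step /pushforward.
congr (product_measure1 _ _ _); apply/seteqP.
split => z /=; rewrite consrV0 (_ : \row_j _ = z.2)//;
  by apply/rowP => j; rewrite mxE consrVS.
Qed.

Let step_sigma_finite : sigma_finite setT lebesgue_step.
Proof.
have /sigma_finiteP[F [F_T F_nd F_oo]] := sigma_finiteT (@lebesgue_measure R).
have /sigma_finiteP[G [G_T G_nd G_oo]] := sigma_finiteT mu.
exists (fun k => unconsrV @^-1` (F k `*` G k)).
  apply/esym; rewrite -subTset => x _.
  have [i _ Fi] : (\bigcup_i F i) (x 0 ord0) by rewrite -F_T.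
  have [j _ Gj] : (\bigcup_i G i) (\row_j x 0 (lift ord0 j)) by rewrite -G_T.
  exists (maxn i j) => //; split.
  - by move: Fi; exact/subsetPset/F_nd/leq_maxl.
  - by move: Gj; exact/subsetPset/G_nd/leq_maxr.
move=> k; have [mF Foo] := F_oo k; have [mG Goo] := G_oo k; split; last first.
  by rewrite lebesgue_stepE// lte_mul_pinfty// ge0_fin_numE.
rewrite -[X in measurable X]setTI; apply: measurable_unconsrV => //.
exact: measurableX.
Qed.

HB.instance Definition _ := Measure_isSigmaFinite.Build _ _ _ lebesgue_step
  step_sigma_finite.

End lebesgue_step.

(* Borel Lebesgue measure on R^N as iterated product of the one-dimensional
   one; [lebesgue_rV_box] characterizes it. *)
Fixpoint lebesgue_rV {R : realType} (N : nat) :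
    {sigma_finite_measure set 'rV[R]_N -> \bar R} :=
  if N is n.+1 then lebesgue_step (lebesgue_rV n) else \d_(0 : 'rV[R]_0).

Lemma lebesgue_rV_box {R : realType} (N : nat)
    (A : 'I_N -> set (measurableTypeR R)) : (forall i, measurable (A i)) ->
  lebesgue_rV N [set x | forall i, A i (x 0 i)] =
  (\prod_(i < N) lebesgue_measure (A i))%E.
Proof.
move=> mA; elim: N => [|n IHn] in A mA *.
  rewrite big_ord0; transitivity (lebesgue_rV 0 (@setT 'rV[R]_0)).
    by congr (lebesgue_rV 0 _); apply/funext => x; apply/propext; split=> // _ [].
  exact: probability_setT.
rewrite big_ord_recl -(IHn (fun i => A (lift ord0 i)))//.
pose B := [set x : 'rV[R]_n | forall i, A (lift ord0 i) (x 0 i)].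
have mB : measurable B.
  rewrite (_ : B = \bigcap_(i in [set: 'I_n])
      ((fun x : 'rV[R]_n => x 0 i) @^-1` A (lift ord0 i))).
    apply: fin_bigcap_measurable => // i _.
    by rewrite -[X in measurable X]setTI; exact: measurable_coord.
  by apply/seteqP; split=> [x Ax i _|x Ax i]; exact: Ax.
rewrite -(lebesgue_stepE (lebesgue_rV n) (mA ord0) mB).
congr (lebesgue_rV n.+1 _); apply/funext => x; apply/propext; split=> /=.
  by move=> Ax; split=> [|j]; rewrite ?mxE; exact: Ax.
move=> [A0 AS] i.
by have [j ->|->//] := unliftP ord0 i; have := AS j; rewrite mxE.
Qed.

Definition enorm {R : realType} {N : nat} (x : 'rV[R]_N) : R :=
  Num.sqrt (\sum_(i < N) x 0 i ^+ 2).

Definition enorm_ball {R : realType} {N : nat} (r : R) : set 'rV[R]_N :=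
  [set x | enorm x <= r].

(* [cNs] is the normalizing constant; as [powR] vanishes at 0 for a nonzero
   exponent, the kernel takes the value 0 on the null set y = x. *)
Definition riesz_potential {R : realType} {N : nat} (cNs sigma : R)
    (f : 'rV[R]_N -> R) (x : 'rV[R]_N) : \bar R :=
  (cNs%:E * \int[lebesgue_rV N]_y (f y / enorm (x - y) `^ (N%:R - sigma))%:E)%E.

Definition spacetime {R : realType} {N : nat} : set (R * 'rV[R]_N) :=
  [set z | 0 <= z.1].

Definition lebesgue_spacetime {R : realType} (N : nat) :
    {measure set (measurableTypeR R * 'rV[R]_N) -> \bar R} :=
  (lebesgue_measure \x lebesgue_rV N)%E.

Definition L1loc {R : realType} {N : nat} (f : 'rV[R]_N -> R) : Prop :=
  measurable_fun setT f /\
  forall K : set 'rV[R]_N, compact K ->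
    (\int[lebesgue_rV N]_(x in K) `|f x|%:E < +oo)%E.

Definition Lploc_spacetime {R : realType} {N : nat} (p : R)
    (f : R -> 'rV[R]_N -> \bar R) : Prop :=
  measurable_fun (@spacetime R N)
    (fun z : measurableTypeR R * 'rV[R]_N => f z.1 z.2) /\
  forall K : set (R * 'rV[R]_N), K `<=` @spacetime R N -> compact K ->
    (\int[lebesgue_spacetime N]_(z in K) `|f z.1 z.2| `^ p < +oo)%E.

Definition dt {R : realType} {N : nat} (phi : R -> 'rV[R]_N -> R)
    (t : R) (x : 'rV[R]_N) : R := derive1 (fun s => phi s x) t.

Definition dx {R : realType} {N : nat} (i : 'I_N) (f : 'rV[R]_N -> R)
    (x : 'rV[R]_N) : R := 'D_(delta_mx 0 i) f x.

Definition laplacian {R : realType} {N : nat} (f : 'rV[R]_N -> R)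
    (x : 'rV[R]_N) : R := \sum_(i < N) dx i (dx i f) x.

Definition strip_continuous {R : realType} {N : nat} (T : R)
    (phi : R -> 'rV[R]_N -> R) : Prop :=
  {within [set z : R * 'rV[R]_N | 0 <= z.1 <= T],
    continuous (fun z => phi z.1 z.2)}.

(* C^{1,2}([0,T] x R^N); by the mean value theorem, asking the time derivative
   on ]0,T[ to extend continuously to [0,T] is the same as asking for a
   continuous derivative on [0,T] that is one-sided at the endpoints. *)
Definition C12 {R : realType} {N : nat} (T : R)
    (phi : R -> 'rV[R]_N -> R) : Prop :=
  [/\ strip_continuous T phi,
      exists2 psi, strip_continuous T psi &
        forall t x, 0 < t < T ->
          is_derive t (1 : R) (fun s => phi s x) (psi t x),
      forall i,
        (forall t x, 0 <= t <= T -> derivable (phi t) x (delta_mx 0 i)) /\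
        strip_continuous T (fun t => dx i (phi t)) &
      forall i j,
        (forall t x, 0 <= t <= T ->
          derivable (dx j (phi t)) x (delta_mx 0 i)) /\
        strip_continuous T (fun t => dx i (dx j (phi t)))].

Definition test_function {R : realType} {N : nat} (T : R)
    (phi : R -> 'rV[R]_N -> R) : Prop :=
  [/\ C12 T phi,
      forall t x, 0 <= t <= T -> 0 <= phi t x,
      exists2 K : set 'rV[R]_N, compact K &
        forall t x, 0 <= t <= T -> ~ K x -> phi t x = 0 &
      forall x, phi T x = 0].

(* The integrals are extended-real because [w] may take the value +oo on a null
   set; all of them are finite when w is in L^1_loc, u0 in L^1_loc and u in
   L^p_loc. They run over ]0,T[, where [dt phi] is a genuine derivative. *)
Definition global_weak_solution {R : realType} {N : nat} (p : R)
    (w : R -> 'rV[R]_N -> \bar R) (u0 : 'rV[R]_N -> R)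
    (u : R -> 'rV[R]_N -> R) : Prop :=
  [/\ Lploc_spacetime p (fun t x => (u t x)%:E),
      {ae lebesgue_spacetime N, forall z, 0 <= z.1 -> 0 <= u z.1 z.2} &
      forall (T : R) (phi : R -> 'rV[R]_N -> R), 0 < T -> test_function T phi ->
        (\int[lebesgue_measure]_(t in `]0%R, T[) \int[lebesgue_rV N]_x
            (((`|u t x| `^ p)%:E + w t x) * (phi t x)%:E)
         + \int[lebesgue_rV N]_x (u0 x * phi 0%R x)%:E
         = - (\int[lebesgue_measure]_(t in `]0%R, T[) \int[lebesgue_rV N]_x
               (u t x * dt phi t x)%:E)
           - \int[lebesgue_measure]_(t in `]0%R, T[) \int[lebesgue_rV N]_x
               (u t x * laplacian (phi t) x)%:E)%E].

(* Main.v *)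
Require Import Defs.
From mathcomp Require Import all_boot all_order all_algebra.
From mathcomp Require Import all_classical all_reals all_analysis.
From mathcomp Require Import measurable_realfun.
From mathcomp Require Import ring lra.
Import Order.TTheory GRing.Theory Num.Theory.
Import numFieldNormedType.Exports.
Local Open Scope classical_set_scope.
Local Open Scope ring_scope.
Set Implicit Arguments.
Unset Strict Implicit.

(** Lower bound on the forcing.  If |x| <= r and |y| <= r then |x - y| <= 2r,
    so the Riesz kernel is at least (2r)^(sigma-N) on the ball of radius r, and
    the mass hypothesis on g gives the pointwise bound
      w(x,t) >= cNs c0 (2r)^(sigma-N) t^m   for |x| <= r, r >= R0, t >= 1
    ([riesz_forcing_ge]).  Integrating it over a cube of side comparable to r
    inside the ball, with r the square root of T, yields the growth
    T^(sigma/2) t^m ([riesz_forcing_mass_ge]).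

    Nonexistence is by the test function method.  Take T = r^2 and test with
      phi(t,x) = max(0, 1 - (t + |x|^2) / r^2)^(k+3),
    which is supported in |x| <= r, vanishes at t = r^2, and is C^2 because its
    exponent is at least 3.  Its time derivative and its Laplacian are at most
    D psi^(k+1), where psi is the truncated paraboloid and D is of order r^(-2)
    ([dt_cutoff_le], [laplacian_cutoff_le]).  With p' = p/(p-1), once
    k + 1 >= 2/(p-1) Young's inequality bounds each of |u phi_t| and
    |u Laplacian(phi)| by half of |u|^p phi plus C D^(p') ([young_absorb]).
    The two halves cancel the finite term |u|^p phi of the weak formulation and
    leave ([weak_solution_mass_le])
      iint w phi <= C r^(-2p') r^(N+2).
    The pointwise lower bound on w, used where r^2/4 <= t <= r^2/2 and
    |x| <= r/2, gives
      iint w phi >= c r^(sigma-N) r^(2m) r^(N+2).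
    Hence r^(2p' + 2m + sigma - N) stays bounded as r grows, although the
    assumption on p makes this exponent positive ([exponent_gap]). *)

(** * Monotonicity of the integral for arbitrary functions *)

Section integral_monotonicity.
Context d (T : measurableType d) (R : realType).
Variable mu : {measure set T -> \bar R}.
Local Open Scope ereal_scope.

(** The integral of a nonnegative function is a supremum over the simple
    functions below it, so it is monotone whether or not the functions are
    measurable; this spares measurability proofs for the forcing and for the
    inner integrals. *)
Lemma le_integral_ge0 (D : set T) (f g : T -> \bar R) :
  (forall x, D x -> 0 <= f x) -> (forall x, D x -> f x <= g x) ->
  \int[mu]_(x in D) f x <= \int[mu]_(x in D) g x.
Proof.
move=> f0 fg; have g0 x : D x -> 0 <= g x.
  by move=> Dx; apply: le_trans (fg _ Dx); exact: f0.
rewrite !ge0_integralE//; apply: ereal_sup_le => _ [h hf <-].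
by exists h => // x; apply: le_trans (hf x) _; exact: lee_restrict.
Qed.

(** The integral is the difference of the integrals of the positive and negative
    parts, and the negative part of f lies below h.  The convention
    +oo - +oo = -oo does no harm: the integral of h is then +oo. *)
Lemma oppe_integral_le (D : set T) (f h : T -> \bar R) :
  (forall x, D x -> 0 <= h x) -> (forall x, D x -> - f x <= h x) ->
  - (\int[mu]_(x in D) f x) <= \int[mu]_(x in D) h x.
Proof.
move=> h0 fh; rewrite integralE.
have : \int[mu]_(x in D) f^\- x <= \int[mu]_(x in D) h x.
  apply: le_integral_ge0 => // x Dx.
  by rewrite funenegE ge_max fh// h0.
have : 0 <= \int[mu]_(x in D) f^\+ x by exact: integral_ge0.
have : 0 <= \int[mu]_(x in D) f^\- x by exact: integral_ge0.
case: (integral mu D f^\+) => [a| |]//; case: (integral mu D f^\-) => [b| |]//.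
move=> b0 a0; apply: le_trans.
by rewrite -EFinB -EFinN lee_fin opprB lerBlDr lerDl -lee_fin.
by move=> _ _ _; exact: leNye.
Qed.

Lemma integral_set_mono (A B : set T) (f : T -> \bar R) : A `<=` B ->
  (forall x, B x -> 0 <= f x) ->
  \int[mu]_(x in A) f x <= \int[mu]_(x in B) f x.
Proof.
move=> AB f0; rewrite [leLHS]integral_mkcond [leRHS]integral_mkcond.
apply: le_integral_ge0 => x _.
  by apply: erestrict_ge0 => y /AB; exact: f0.
rewrite /patch; case: ifPn => [|_].
  by rewrite inE => /AB Bx; rewrite mem_set.
by case: ifPn; rewrite // inE; exact: f0.
Qed.

Lemma integral_ge_cst (D A : set T) (c : \bar R) (f : T -> \bar R) :
  measurable A -> A `<=` D -> 0 <= c -> (forall x, D x -> 0 <= f x) ->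
  (forall x, A x -> c <= f x) -> c * mu A <= \int[mu]_(x in D) f x.
Proof.
move=> mA AD c0 f0 cf; apply: (@le_trans _ _ (\int[mu]_(x in A) f x)); last first.
  exact: integral_set_mono.
by rewrite -integral_cst//; apply: le_integral_ge0.
Qed.

End integral_monotonicity.

(** * Euclidean balls and cubes *)

Section euclidean.
Context {R : realType} {N : nat}.
Implicit Types x y : 'rV[R]_N.

Lemma sqn_ge0 x : 0 <= \sum_(i < N) x 0 i ^+ 2.
Proof. by apply: sumr_ge0 => i _; exact: sqr_ge0. Qed.

Lemma enorm_leP x (r : R) : 0 <= r ->
  (enorm x <= r) = (\sum_(i < N) x 0 i ^+ 2 <= r ^+ 2).
Proof.
move=> r0; rewrite -[in LHS](ger0_norm r0) -sqrtr_sqr /enorm.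
by rewrite ler_psqrt// nnegrE ?sqn_ge0 ?sqr_ge0.
Qed.

Lemma enorm_ge0 x : 0 <= enorm x. Proof. exact: sqrtr_ge0. Qed.

Lemma enorm_eq0 x : enorm x = 0 -> x = 0.
Proof.
move=> /eqP; rewrite sqrtr_eq0 => s0; apply/rowP => i; rewrite mxE.
have s00 : \sum_(i < N) x 0 i ^+ 2 = 0 by apply/le_anti; rewrite s0 sqn_ge0.
have := psumr_eq0P (fun i _ => sqr_ge0 (x 0 i)) s00.
by move=> /(_ i isT)/eqP; rewrite sqrf_eq0 => /eqP.
Qed.

(** Coordinatewise, (a - b)^2 <= 2 a^2 + 2 b^2. *)
Lemma enorm_sub_le x y (r : R) : enorm x <= r -> enorm y <= r ->
  enorm (x - y) <= 2 * r.
Proof.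
move=> xr yr; have r0 : 0 <= r := le_trans (enorm_ge0 x) xr.
move: xr yr; rewrite !enorm_leP ?mulr_ge0// => xr yr.
apply: (@le_trans _ _ (\sum_i (2 * x 0 i ^+ 2 + 2 * y 0 i ^+ 2))).
  by apply: ler_sum => i _; rewrite !mxE; have := sqr_ge0 (x 0 i + y 0 i); nra.
by rewrite big_split/= -!mulr_sumr; nra.
Qed.

Definition cube (r : R) : set 'rV[R]_N :=
  [set x | forall i, `[- r, r]%classic (x 0 i)].

Lemma measurable_box (A : 'I_N -> set (measurableTypeR R)) :
  (forall i, measurable (A i)) ->
  measurable [set x : 'rV[R]_N | forall i, A i (x 0 i)].
Proof.
move=> mA; rewrite (_ : mkset _ = \bigcap_(i in [set: 'I_N])
    ((fun x : 'rV[R]_N => x 0 i) @^-1` A i)).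
  apply: fin_bigcap_measurable => // i _.
  by rewrite -[X in measurable X]setTI; exact: measurable_coord.
by apply/seteqP; split=> [x Ax i _|x Ax i]; exact: Ax.
Qed.

Lemma measurable_cube r : measurable (cube r).
Proof. apply: (@measurable_box (fun=> `[- r, r]%classic)) => i.
exact: measurable_itv. Qed.

Lemma compact_cube r : compact (cube r).
Proof. by apply: (@rV_compact _ _ (fun=> `[- r, r]%classic)) => i; exact: segment_compact. Qed.

Lemma lebesgue_cube (r : R) : 0 <= r ->
  lebesgue_rV N (cube r) = ((2 * r) ^+ N)%:E.
Proof.
move=> r0; rewrite (@lebesgue_rV_box R N (fun=> `[- r, r]%classic)); last first.
  by move=> i; exact: measurable_itv.
have -> : lebesgue_measure (`[- r, r]%classic : set (measurableTypeR R)) = (2 * r)%:E.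
  rewrite lebesgue_measure_itv/= lte_fin; case: ltP => [_|rr].
    by rewrite -EFinB; congr EFin; ring.
  by congr EFin; lra.
by rewrite prodEFin prodr_const card_ord.
Qed.

Lemma lebesgue_rV_set1 x : (0 < N)%N -> lebesgue_rV N [set x] = 0%E.
Proof.
move=> N0; rewrite (_ : [set x] = [set y | forall i, [set x 0 i] (y 0 i)]).
  rewrite (@lebesgue_rV_box R N (fun i => [set x 0 i])); last first.
    by move=> i; exact: measurable_set1.
  under eq_bigr do rewrite lebesgue_measure_set1.
  by case: N N0 x => // n _ x; rewrite big_ord_recl mul0e.
apply/seteqP; split => [_ -> //|y /= yx].
by apply/rowP => i; rewrite yx.
Qed.

Lemma measurable_set1_rV x : measurable [set x].
Proof.
rewrite (_ : [set x] = [set y | forall i, [set x 0 i] (y 0 i)]).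
  by apply: (@measurable_box (fun i => [set x 0 i])) => i; exact: measurable_set1.
apply/seteqP; split => [_ -> //|y /= yx].
by apply/rowP => i; rewrite yx.
Qed.

Lemma measurable_sqn :
  measurable_fun [set: 'rV[R]_N] (fun x => \sum_(i < N) x 0 i ^+ 2).
Proof.
apply: measurable_sum => i; apply: measurable_funX; exact: measurable_coord.
Qed.

Lemma measurable_enorm_ball (r : R) : 0 <= r ->
  measurable (enorm_ball r : set 'rV[R]_N).
Proof.
move=> r0; rewrite (_ : enorm_ball r =
    (fun x : 'rV[R]_N => \sum_(i < N) x 0 i ^+ 2) @^-1` `]-oo, r ^+ 2]%classic).
  by rewrite -[X in measurable X]setTI; exact: measurable_sqn.
by apply/seteqP; split => x /=; rewrite in_itv/= -enorm_leP.
Qed.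

(** The side r/N is a crude choice, but it keeps square roots out of the volume:
    N (r/N)^2 <= r^2. *)
Lemma cube_sub_enorm_ball (r : R) : 0 <= r ->
  cube (r / N%:R) `<=` (enorm_ball r : set 'rV[R]_N).
Proof.
move=> r0 x xr; rewrite /enorm_ball/= enorm_leP//.
have [N0|N0] := posnP N.
  rewrite big1 ?sqr_ge0// => i _; move: (ltn_ord i).
  by rewrite {2}N0.
have NR : 1 <= N%:R :> R by rewrite ler1n.
apply: (@le_trans _ _ (\sum_(i < N) (r / N%:R) ^+ 2)).
  apply: ler_sum => i _; have := xr i; rewrite /= in_itv/= -ler_norml => xi.
  by rewrite -real_normK ?num_real// lerXn2r// nnegrE// divr_ge0.
rewrite sumr_const card_ord -mulr_natl expr_div_n expr2.
rewrite [leLHS](_ : _ = r ^+ 2 * N%:R^-1); last by field; lra.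
by rewrite ler_piMr ?sqr_ge0// invf_le1// (lt_le_trans ltr01).
Qed.

End euclidean.

(** * Lower bounds on the Riesz potential *)

Section riesz.
Context {R : realType} {N : nat}.

Lemma riesz_potential_ge0 (c sigma : R) (f : 'rV[R]_N -> R) x :
  0 <= c -> (forall y, 0 <= f y) -> (0 <= riesz_potential c sigma f x)%E.
Proof.
move=> c0 f0; rewrite /riesz_potential mule_ge0 ?lee_fin//.
by apply: integral_ge0 => y _; rewrite lee_fin divr_ge0 ?powR_ge0.
Qed.

(** Restricting the potential to the ball of radius r only decreases it, and
    there |x - y| <= 2r bounds the kernel from below.  The point y = x, where
    the formula of the kernel takes the value 0, is removed first: it is a null
    set as N > 0. *)
Lemma riesz_potential_ge (c sigma r M : R) (f : 'rV[R]_N -> R) x :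
  0 < sigma < N%:R -> 0 <= c -> (forall y, 0 <= f y) -> measurable_fun setT f ->
  0 < r -> enorm x <= r ->
  (M%:E <= \int[lebesgue_rV N]_(y in enorm_ball r) (f y)%:E)%E ->
  ((c * ((2 * r) `^ (N%:R - sigma))^-1 * M)%:E <= riesz_potential c sigma f x)%E.
Proof.
move=> /andP[s0 sN] c0 f0 mf r0 xr fM.
have N0 : (0 < N)%N by rewrite -(ltr0n R) (lt_trans s0).
have k0 : 0 < (2 * r) `^ (N%:R - sigma) by rewrite powR_gt0 ?mulr_gt0.
rewrite /riesz_potential -mulrA EFinM lee_wpmul2l ?lee_fin//.
have mB := measurable_enorm_ball (ltW r0) : measurable (enorm_ball r : set 'rV[R]_N).
have mx := measurable_set1_rV x.
have mfB D : measurable_fun D (fun y => (f y)%:E).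
  by apply/measurable_EFinP; apply: measurable_funTS.
rewrite EFinM (@le_trans _ _ ((((2 * r) `^ (N%:R - sigma))^-1)%:E *
    \int[lebesgue_rV N]_(y in enorm_ball r `\ x) (f y)%:E)%E)//.
  rewrite lee_wpmul2l ?lee_fin ?invr_ge0 ?(ltW k0)//.
  rewrite -(@ge0_negligible_integral _ _ _ (lebesgue_rV N) _ [set x])//.
    by move=> y _; rewrite lee_fin.
  exact: lebesgue_rV_set1.
rewrite -ge0_integralZl_EFin//; last 3 first.
- exact: measurableD.
- by move=> y _; rewrite lee_fin.
- by rewrite invr_ge0 ltW.
apply: (@le_trans _ _ (\int[lebesgue_rV N]_(y in enorm_ball r `\ x)
    (f y / enorm (x - y) `^ (N%:R - sigma))%:E)%E); last first.
  apply: integral_set_mono => // y _.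
  by rewrite lee_fin divr_ge0 ?powR_ge0.
apply: le_integral_ge0 => y [yr yx].
  by rewrite -EFinM lee_fin mulr_ge0// invr_ge0 ltW.
rewrite -EFinM lee_fin mulrC ler_wpM2l//.
have xy0 : 0 < enorm (x - y).
  rewrite lt_neqAle enorm_ge0 andbT eq_sym; apply/eqP => /enorm_eq0/eqP.
  by rewrite subr_eq0 => /eqP xy; apply: yx; rewrite /= xy.
rewrite lef_pV2 ?posrE ?powR_gt0 ?mulr_gt0//.
apply: ge0_ler_powR.
- by rewrite subr_ge0 ltW.
- by rewrite nnegrE ltW.
- by rewrite nnegrE mulr_ge0// ltW.
- exact: enorm_sub_le.
Qed.

Lemma measurable_section_ge0 (g : 'rV[R]_N -> R -> R) (t : R) :
  measurable_fun ([set z | 0 <= z.2] : set ('rV[R]_N * measurableTypeR R))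
    (fun z => g z.1 z.2) -> 0 <= t -> measurable_fun setT (fun y => g y t).
Proof.
move=> mg t0.
apply: (measurable_comp _ _ mg (_ : measurable_fun setT
   (fun y : 'rV[R]_N => (y, t : measurableTypeR R)))) => //.
- rewrite (_ : mkset _ = snd @^-1` `[0, +oo[%classic); last first.
    by apply/seteqP; split => z /=; rewrite in_itv/= andbT.
  rewrite -[X in measurable X]setTI; apply: measurable_snd => //.
- by move=> _ [y _ <-].
Qed.

Lemma riesz_forcing_ge (sigma m cNs c0 R0 : R) (g : 'rV[R]_N -> R -> R)
    (r t : R) x :
  0 < sigma < N%:R -> 0 < cNs ->
  measurable_fun ([set z | 0 <= z.2] : set ('rV[R]_N * measurableTypeR R))
    (fun z => g z.1 z.2) ->
  (forall y t, 0 <= t -> 0 <= g y t) -> 1 <= R0 ->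
  (forall t r, 1 <= t -> R0 <= r ->
     ((c0 * t `^ m)%:E <=
      \int[lebesgue_rV N]_(y in enorm_ball r) (g y t)%:E)%E) ->
  1 <= t -> R0 <= r -> enorm x <= r ->
  ((cNs * ((2 * r) `^ (N%:R - sigma))^-1 * (c0 * t `^ m))%:E
     <= riesz_potential cNs sigma (fun y => g y t) x)%E.
Proof.
move=> sN cN mg g0 R01 hg t1 rR xr.
have t0 : 0 <= t := le_trans ler01 t1.
apply: riesz_potential_ge => //.
- exact: ltW.
- by move=> y; exact: g0.
- exact: measurable_section_ge0.
- by rewrite (lt_le_trans _ rR)// (lt_le_trans ltr01).
- exact: hg.
Qed.

Lemma riesz_forcing_mass_ge (sigma m cNs c0 R0 : R) (g : 'rV[R]_N -> R -> R) :
  0 < sigma < N%:R -> 0 < cNs ->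
  measurable_fun ([set z | 0 <= z.2] : set ('rV[R]_N * measurableTypeR R))
    (fun z => g z.1 z.2) ->
  (forall y t, 0 <= t -> 0 <= g y t) -> 0 < c0 -> 1 <= R0 ->
  (forall t r, 1 <= t -> R0 <= r ->
     ((c0 * t `^ m)%:E <=
      \int[lebesgue_rV N]_(y in enorm_ball r) (g y t)%:E)%E) ->
  exists2 c : R, 0 < c &
    forall T t : R, Num.max 1 (R0 ^+ 2) <= T -> 1 <= t ->
      ((c * T `^ (sigma / 2) * t `^ m)%:E <=
       \int[lebesgue_rV N]_(x in enorm_ball (Num.sqrt T))
         riesz_potential cNs sigma (fun y => g y t) x)%E.
Proof.
move=> sN cN mg g0 c00 R01 hg; have /andP[s0 sN'] := sN.
have NR : 0 < N%:R :> R := lt_trans s0 sN'.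
(* (2r)^(sigma-N) times the volume (2r/N)^N of the cube is (2r)^sigma / N^N *)
exists (cNs * c0 * 2 `^ sigma * (N%:R ^+ N)^-1).
  by rewrite !mulr_gt0 ?invr_gt0 ?exprn_gt0 ?powR_gt0.
move=> T t; rewrite ge_max => /andP[T1 TR] t1.
have T0 : 0 < T := lt_le_trans ltr01 T1.
set r := Num.sqrt T.
have r0 : 0 < r by rewrite sqrtr_gt0.
have rR : R0 <= r.
  have R00 : 0 <= R0 := le_trans ler01 R01.
  by rewrite -(ger0_norm R00) -sqrtr_sqr ler_wsqrtr.
have TE : T `^ (sigma / 2) = r `^ sigma.
  by rewrite /r -powR12_sqrt ?(ltW T0)// -powRrM mulrC.
pose K := cNs * ((2 * r) `^ (N%:R - sigma))^-1 * (c0 * t `^ m).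
apply: le_trans (@integral_ge_cst _ _ _ _ _ _ K%:E _
  (measurable_cube (r / N%:R)) (cube_sub_enorm_ball (ltW r0)) _ _ _);
  last 3 first.
- rewrite lee_fin /K.
  by rewrite !mulr_ge0 ?invr_ge0 ?powR_ge0 ?ltW.
- move=> x _; apply: riesz_potential_ge0 => [|y]; first exact: ltW.
  by rewrite g0// (le_trans ler01).
- move=> x xr; apply: (@riesz_forcing_ge _ _ _ c0 R0) => //.
  exact: (cube_sub_enorm_ball (ltW r0)).
rewrite [X in (_ <= _ * X)%E](_ : _ = ((2 * (r / N%:R)) ^+ N)%:E); last first.
  by apply: lebesgue_cube; rewrite divr_ge0 ?ltW.
rewrite -EFinM lee_fin TE /K le_eqVlt; apply/orP; left; apply/eqP.
have r20 : 0 < 2 * r by rewrite mulr_gt0.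
rewrite powRB ?(gt_eqF r20) ?implybT//.
rewrite powR_mulrn ?mulr_ge0 ?(ltW r0)// powRM ?(ltW r0)//.
rewrite [2 * (r / _)]mulrA expr_div_n; field.
by rewrite !gt_eqF ?powR_gt0 ?exprn_gt0.
Qed.

End riesz.

(** * Powers of the positive part *)

Section positive_power.
Context {R : realType}.
Implicit Types (s : R) (k : nat).

Definition pospow k s : R := Num.max s 0 ^+ k.

Lemma is_derive_quadratic_remainder (f : R -> R) (x a : R) :
  (forall z, `|f z - f x - a * (z - x)| <= (z - x) ^+ 2) -> is_derive x 1 f a.
Proof.
move=> fa; apply/is_derive1_caratheodory.
exists (fun z => if z == x then a else (f z - f x) / (z - x)); split.
- move=> z; case: eqVneq => [->|zx]; first by rewrite !subrr mulr0.
  by rewrite divfK// subr_eq0.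
- apply/cvgrPdist_le => e e0; near=> z.
  have zxe : `|z - x| <= e.
    by rewrite distrC; near: z; exact: (@cvgr_dist_le _ _ _ _ _ id x).
  rewrite eqxx; case: eqVneq => [_|zx]; first by rewrite subrr normr0 ltW.
  have zx0 : z - x != 0 by rewrite subr_eq0.
  rewrite distrC (_ : _ - a = (f z - f x - a * (z - x)) / (z - x)); last first.
    by rewrite [RHS]mulrBl mulfK.
  rewrite normrM normfV ler_pdivrMr ?normr_gt0//.
  apply: (le_trans (fa z)).
  by rewrite -real_normK ?num_real// expr2 ler_wpM2r.
- by rewrite eqxx.
Unshelve. all: by end_near. Qed.

(** Induction on the exponent through pospow (k+1) z = z * pospow k z, valid for
    k > 0.  In the base case the square of the positive part has a 2-Lipschitz
    derivative, so its second order Taylor remainder is at most (z - s)^2. *)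
Lemma is_derive_pospow k s :
  is_derive s (1 : R) (pospow k.+2) (k.+2%:R * pospow k.+1 s).
Proof.
elim: k => [|k ih].
  apply: is_derive_quadratic_remainder => z.
  rewrite /pospow /= expr1 ler_norml.
  have := sqr_ge0 (z - s); have := sqr_ge0 z; have := sqr_ge0 s.
  case: (leP z 0) => z0; case: (leP s 0) => s0; rewrite !expr2 => h1 h2 h3.
  - by apply/andP; split; lra.
  - have sz : s * z <= 0 by rewrite pmulr_rle0.
    by apply/andP; split; lra.
  - have sz : z * s <= 0 by rewrite pmulr_rle0.
    by apply/andP; split; lra.
  - by apply/andP; split; lra.
have -> : pospow k.+3 = id * pospow k.+2 :> (R -> R).
  apply/funext => z; rewrite /pospow fctE/= exprS.
  by case: (leP z 0) => // _; rewrite expr0n/= !mulr0.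
apply: is_derive_eq; rewrite /=.
rewrite -[LHS]/(s * (k.+2%:R * pospow k.+1 s) + pospow k.+2 s * 1).
have -> : pospow k.+2 s = s * pospow k.+1 s.
  rewrite /pospow exprS.
  by case: (leP s 0) => // _; rewrite expr0n/= !mulr0.
rewrite (_ : k.+3%:R = k.+2%:R + 1 :> R); last by rewrite natr1.
by ring.
Qed.

Lemma pospow_ge0 k s : 0 <= pospow k s.
Proof. by rewrite exprn_ge0// le_max lexx orbT. Qed.

Lemma pospow_le0 k s : s <= 0 -> pospow k.+1 s = 0.
Proof. by move=> s0; rewrite /pospow max_r// expr0n. Qed.

Lemma continuous_pospow k : continuous (pospow k).
Proof.
move=> s; rewrite /pospow.
apply: (@continuous_comp _ _ _ (fun s => Num.max s 0) (fun s => s ^+ k)).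
  by apply: continuous_max => //; exact: cvg_cst.
exact: exprn_continuous.
Qed.

Lemma measurable_pospow k : measurable_fun setT (pospow k).
Proof. by apply: measurable_funX; apply: measurable_maxr. Qed.

End positive_power.

(** * The test function *)

Section cutoff.
Context {R : realType} {N : nat}.
Implicit Types (r t : R) (x : 'rV[R]_N) (k : nat) (i j : 'I_N).

(** Directional derivatives are one-dimensional derivatives along a line, which
    makes the one-variable chain rule available. *)
Lemma is_derive_line (V : normedModType R) (f : V -> R) (x v : V) (df : R) :
  is_derive (0 : R) 1 (fun h : R => f (h *: v + x)) df -> is_derive x v f df.
Proof.
move=> [dl <-]; apply: DeriveDef; first exact/derivable1P.
rewrite /derive; set g1 := fun h => h^-1 *: _; set g2 := fun h => h^-1 *: _.
suff -> : g1 = g2 by [].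
by rewrite funeqE /g1 /g2 => h /=; rewrite addr0 scale0r add0r [_%:A]mulr1.
Qed.

Definition paraboloid r t x : R := 1 - (t + \sum_(i < N) x 0 i ^+ 2) / r ^+ 2.

Definition cutoff r k t x : R := pospow k (paraboloid r t x).

Lemma cutoff_ge0 r k t x : 0 <= cutoff r k t x.
Proof. exact: pospow_ge0. Qed.

Lemma paraboloid_le1 r t x : 0 <= t -> paraboloid r t x <= 1.
Proof.
move=> t0; rewrite /paraboloid lerBlDr lerDl divr_ge0 ?sqr_ge0//.
by rewrite addr_ge0// sqn_ge0.
Qed.

Lemma cutoff_eq0 r k t x : 0 < r -> r ^+ 2 <= t + \sum_(i < N) x 0 i ^+ 2 ->
  cutoff r k.+1 t x = 0.
Proof.
move=> r0 rt; apply: pospow_le0; rewrite subr_le0 ler_pdivlMr ?exprn_gt0//.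
by rewrite mul1r.
Qed.

Lemma is_derive_cutoff_time r k t x :
  is_derive t (1 : R) (fun s => cutoff r k.+2 s x)
    (- (k.+2%:R / r ^+ 2) * cutoff r k.+1 t x).
Proof.
rewrite /cutoff.
have dq : is_derive t (1 : R) (fun s => paraboloid r s x) (- (r ^+ 2)^-1).
  rewrite (_ : (fun s => _) = (fun s =>
      cst (1 - (\sum_(i < N) x 0 i ^+ 2) / r ^+ 2) s - (r ^+ 2)^-1 *: s));
    last first.
    by apply/funext => s; rewrite /paraboloid /cst -[_ *: _]/(_ * _); ring.
  by apply: is_derive_eq; rewrite add0r -[_ *: _]/(_ * _) mulr1.
apply: (@is_derive_eq _ _ _ _ _ _ _ _ (@is_derive1_comp _ (pospow k.+2)
  (fun s => paraboloid r s x) t _ _ (is_derive_pospow k _) dq)).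
by ring.
Qed.

Lemma paraboloid_line r t x i (h : R) :
  paraboloid r t (h *: delta_mx 0 i + x) =
  paraboloid r t x - (2 * x 0 i * h + h ^+ 2) / r ^+ 2.
Proof.
rewrite /paraboloid (_ : \sum_(j < N) (h *: delta_mx 0 i + x) 0 j ^+ 2 =
  \sum_(j < N) x 0 j ^+ 2 + (2 * x 0 i * h + h ^+ 2)); first by ring.
rewrite (bigD1 i)//= [in RHS](bigD1 i)//= !mxE !eqxx mulr1.
rewrite (eq_bigr (fun j => x 0 j ^+ 2)) => [|j ji]; first by ring.
by rewrite !mxE (negbTE ji) andbF mulr0 add0r.
Qed.

Lemma is_derive_cutoff_space r k t x i :
  is_derive x (delta_mx 0 i : 'rV[R]_N) (cutoff r k.+2 t)
    (- (2 * k.+2%:R / r ^+ 2) * (x 0 i * cutoff r k.+1 t x)).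
Proof.
apply: is_derive_line.
rewrite /cutoff (_ : (fun h => _) = pospow k.+2 \o
  (fun h => cst (paraboloid r t x) h
            - (r ^+ 2)^-1 *: ((2 * x 0 i) *: h + h ^+ 2))); last first.
  apply/funext => h /=; rewrite paraboloid_line; congr (pospow _ _).
  by rewrite /cst -[_ *: _]/(_ * _) -[_ *: h]/(_ * _); ring.
apply: (@is_derive_eq _ _ _ _ _ _ _ _
  (@is_derive1_comp _ _ _ _ _ _ (is_derive_pospow k _) _)).
rewrite /= /cst -![_ *: _]/(_ * _) expr0n/=.
rewrite mulr0 addr0 mulr0 subr0.
by ring.
Qed.

Lemma is_derive_coord x i j :
  is_derive x (delta_mx 0 i : 'rV[R]_N) (fun y : 'rV[R]_N => y 0 j) (i == j)%:R.
Proof.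
apply: is_derive_line.
rewrite (_ : (fun h => _) = (fun h : R => (i == j)%:R *: h + cst (x 0 j) h));
  last first.
  apply/funext => h; rewrite !mxE eqxx/= eq_sym /cst -[_ *: _]/(_ * _).
  by rewrite mulrC.
by apply: is_derive_eq; rewrite addr0 -[_ *: _]/(_ * _) mulr1.
Qed.

Lemma dx_cutoff r k t i :
  dx i (cutoff r k.+2 t) =
  (fun x : 'rV[R]_N =>
     - (2 * k.+2%:R / r ^+ 2) * (x 0 i * cutoff r k.+1 t x)).
Proof.
by apply/funext => x; have [_] := is_derive_cutoff_space r k t x i.
Qed.

Lemma is_derive_dx_cutoff r k t x i j :
  is_derive x (delta_mx 0 i : 'rV[R]_N) (dx j (cutoff r k.+3 t))
    (- (2 * k.+3%:R / r ^+ 2) * ((i == j)%:R * cutoff r k.+2 t x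
       - 2 * k.+2%:R / r ^+ 2 * (x 0 i * x 0 j * cutoff r k.+1 t x))).
Proof.
rewrite dx_cutoff; have dj := is_derive_coord x i j.
have dc := is_derive_cutoff_space r k t x i.
rewrite (_ : (fun y : 'rV[R]_N => _) =
  (- (2 * k.+3%:R / r ^+ 2)) *:
    ((fun y : 'rV[R]_N => y 0 j) * cutoff r k.+2 t)).
  by apply: is_derive_eq; rewrite -![_ *: _]/(_ * _); ring.
by apply/funext.
Qed.

Lemma dx2_cutoff r k t i j :
  dx i (dx j (cutoff r k.+3 t)) =
  (fun x : 'rV[R]_N => - (2 * k.+3%:R / r ^+ 2) *
      ((i == j)%:R * cutoff r k.+2 t x
       - 2 * k.+2%:R / r ^+ 2 * (x 0 i * x 0 j * cutoff r k.+1 t x))).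
Proof.
by apply/funext => x; have [_] := is_derive_dx_cutoff r k t x i j.
Qed.

Lemma continuous_coord2 i : continuous (fun z : R * 'rV[R]_N => z.2 0 i).
Proof.
move=> z; apply: (@continuous_comp _ _ _ snd (fun x : 'rV[R]_N => x 0 i)).
  exact: cvg_snd.
exact: coord_continuous.
Qed.

Lemma continuous_cutoff r k :
  continuous (fun z : R * 'rV[R]_N => cutoff r k z.1 z.2).
Proof.
move=> z; apply: (@continuous_comp _ _ _
  (fun z : R * 'rV[R]_N => paraboloid r z.1 z.2) (pospow k));
  last exact: continuous_pospow.
apply: cvgB; first exact: cvg_cst.
apply: cvgMl; apply: cvgD; first exact: cvg_fst.
apply: cvg_big => [|i _]; first exact: add_continuous.
apply: (@continuous_comp _ _ _ (fun z : R * 'rV[R]_N => z.2 0 i)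
  (fun s => s ^+ 2)); last exact: exprn_continuous.
exact: continuous_coord2.
Qed.

Lemma C12_cutoff r k T : C12 T (cutoff r k.+3 : R -> 'rV[R]_N -> R).
Proof.
split.
- exact: continuous_subspaceT (@continuous_cutoff _ _).
- exists (fun t x => - (k.+3%:R / r ^+ 2) * cutoff r k.+2 t x).
    apply: continuous_subspaceT => z; apply: cvgMr; exact: continuous_cutoff.
  by move=> t x _; exact: is_derive_cutoff_time.
- move=> i; split.
    by move=> t x _; have [] := is_derive_cutoff_space r k.+1 t x i.
  rewrite (_ : (fun t => dx i (cutoff r k.+3 t)) = (fun t x =>
      - (2 * k.+3%:R / r ^+ 2) * (x 0 i * cutoff r k.+2 t x))); last first.
    by apply/funext => t; exact: dx_cutoff.
  apply: continuous_subspaceT => z; apply: cvgMr; apply: cvgM.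
    exact: continuous_coord2.
  exact: continuous_cutoff.
- move=> i j; split.
    by move=> t x _; have [] := is_derive_dx_cutoff r k t x i j.
  rewrite (_ : (fun t => dx i (dx j (cutoff r k.+3 t))) = (fun t x =>
      - (2 * k.+3%:R / r ^+ 2) * ((i == j)%:R * cutoff r k.+2 t x
       - 2 * k.+2%:R / r ^+ 2 * (x 0 i * x 0 j * cutoff r k.+1 t x)))); last first.
    by apply/funext => t; exact: dx2_cutoff.
  apply: continuous_subspaceT => z; apply: cvgMr; apply: cvgB.
    by apply: cvgMr; exact: continuous_cutoff.
  apply: cvgMr; apply: cvgM; last exact: continuous_cutoff.
  by apply: cvgM; exact: continuous_coord2.
Qed.

Lemma cube_sqn r x : 0 <= r -> \sum_(i < N) x 0 i ^+ 2 <= r ^+ 2 -> cube r x.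
Proof.
move=> r0 xr i; rewrite /= in_itv/= -ler_norml.
rewrite -(ler_pXn2r (n := 2))// ?nnegrE// real_normK ?num_real//.
apply: le_trans xr; rewrite (bigD1 i)//= lerDl.
by apply: sumr_ge0 => j _; exact: sqr_ge0.
Qed.

Lemma cutoff_cube r k t x : 0 < r -> 0 <= t -> ~ cube r x ->
  cutoff r k.+1 t x = 0.
Proof.
move=> r0 t0 xr; apply: cutoff_eq0 => //.
rewrite leNgt; apply/negP => lt; apply: xr; apply: cube_sqn (ltW r0) _.
by apply: le_trans (ltW lt); rewrite lerDr.
Qed.

Lemma test_function_cutoff r k : 0 < r ->
  test_function (r ^+ 2) (cutoff r k.+3 : R -> 'rV[R]_N -> R).
Proof.
move=> r0; split.
- exact: C12_cutoff.
- by move=> t x _; exact: cutoff_ge0.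
- exists (cube r); first exact: compact_cube.
  by move=> t x /andP[t0 _] xr; exact: cutoff_cube.
- by move=> x; apply: cutoff_eq0 => //; rewrite lerDl sqn_ge0.
Qed.

Lemma dt_cutoff r k t x :
  dt (cutoff r k.+2) t x = - (k.+2%:R / r ^+ 2) * cutoff r k.+1 t x.
Proof.
by rewrite /dt derive1E; have [_ ->] := is_derive_cutoff_time r k t x.
Qed.

Lemma cutoff_mono r k l t x : 0 <= t -> (k <= l)%N ->
  cutoff r l t x <= cutoff r k t x.
Proof.
move=> t0 kl; apply: ler_wiXn2l => //; first by rewrite le_max lexx orbT.
by rewrite ge_max ler01 paraboloid_le1.
Qed.

(** One constant serving both the time derivative and the Laplacian; in each it
    comes with the factor r^(-2), by parabolic scaling. *)
Definition cutoff_bound k : R := 4 * k.+3%:R * (k.+2%:R + N%:R).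

Lemma dt_cutoff_le r k t x : 0 < r -> 0 <= t ->
  `|dt (cutoff r k.+3) t x| <= cutoff_bound k / r ^+ 2 * cutoff r k.+1 t x.
Proof.
move=> r0 t0; rewrite dt_cutoff normrM normrN.
rewrite !ger0_norm ?cutoff_ge0 ?divr_ge0 ?sqr_ge0//.
apply: ler_pM => //; rewrite ?divr_ge0 ?sqr_ge0 ?cutoff_ge0//;
  last exact: cutoff_mono.
rewrite ler_wpM2r ?invr_ge0 ?sqr_ge0// /cutoff_bound.
have : 1 <= k.+2%:R :> R by rewrite ler1n.
have : 0 <= N%:R :> R by [].
have : 0 <= k.+3%:R :> R by [].
by nra.
Qed.

Lemma laplacian_cutoff r k t x :
  laplacian (cutoff r k.+3 t) x = - (2 * k.+3%:R / r ^+ 2) *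
    (N%:R * cutoff r k.+2 t x
      - 2 * k.+2%:R / r ^+ 2 * ((\sum_(i < N) x 0 i ^+ 2) * cutoff r k.+1 t x)).
Proof.
rewrite /laplacian; under eq_bigr do rewrite dx2_cutoff eqxx mul1r -expr2.
rewrite -mulr_sumr sumrB sumr_const card_ord -mulr_sumr -mulr_suml.
by rewrite [N%:R * _]mulr_natl.
Qed.

(** The Laplacian carries the term |x|^2 / r^4 times the lowest power of the
    truncated paraboloid; it is of order r^(-2) because |x|^2 <= r^2 wherever
    that power does not vanish. *)
Lemma laplacian_cutoff_le r k t x : 0 < r -> 0 <= t ->
  `|laplacian (cutoff r k.+3 t) x| <=
  cutoff_bound k / r ^+ 2 * cutoff r k.+1 t x.
Proof.
move=> r0 t0; rewrite laplacian_cutoff.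
have c2 := cutoff_mono r x t0 (leqnSn k.+1).
have c20 := cutoff_ge0 r k.+2 t x.
have sc : (\sum_(i < N) x 0 i ^+ 2) / r ^+ 2 * cutoff r k.+1 t x <=
    cutoff r k.+1 t x.
  have [rt|rt] := leP (r ^+ 2) (t + \sum_(i < N) x 0 i ^+ 2).
    by rewrite cutoff_eq0// mulr0.
  rewrite ler_piMl ?cutoff_ge0// ler_pdivrMr ?exprn_gt0// mul1r.
  by apply: le_trans (ltW rt); rewrite lerDr.
have sc0 : 0 <= (\sum_(i < N) x 0 i ^+ 2) / r ^+ 2 * cutoff r k.+1 t x.
  by rewrite mulr_ge0 ?cutoff_ge0 ?divr_ge0 ?sqn_ge0 ?sqr_ge0.
rewrite [X in `|X|](_ : _ = (r ^+ 2)^-1 * ((2 * k.+3%:R) * (2 * k.+2%:R *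
    ((\sum_(i < N) x 0 i ^+ 2) / r ^+ 2 * cutoff r k.+1 t x)
    - N%:R * cutoff r k.+2 t x))); last first.
  by ring.
move: sc sc0; set a := _ / _ * _ => sc sc0.
rewrite normrM ger0_norm ?invr_ge0 ?sqr_ge0// [leRHS]mulrAC [leRHS]mulrC.
rewrite ler_wpM2l ?invr_ge0 ?sqr_ge0// /cutoff_bound.
rewrite normrM ger0_norm ?mulr_ge0//.
rewrite (_ : 4 * k.+3%:R = (2 * k.+3%:R) * 2); last by ring.
rewrite -!mulrA ler_wpM2l ?mulr_ge0// ler_wpM2l//.
move: sc sc0 c2 c20; move: a (cutoff _ _ _ _) (cutoff _ _ _ _) => a c b ab a0 cb c0.
have k0 : 0 <= k.+2%:R :> R by [].
have n0 : 0 <= N%:R :> R by [].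
have := ler_wpM2l k0 ab; have := ler_wpM2l n0 cb.
have := mulr_ge0 k0 a0; have := mulr_ge0 n0 c0.
by rewrite ler_norml => *; apply/andP; split; lra.
Qed.

Lemma measurable_cutoff r k :
  measurable_fun setT
    (fun z : measurableTypeR R * 'rV[R]_N => cutoff r k z.1 z.2).
Proof.
apply: (measurableT_comp (measurable_pospow k)).
apply: measurable_funB => //; apply: measurable_funM => //.
apply: measurable_funD; first exact: measurable_fst.
exact: (measurableT_comp measurable_sqn measurable_snd).
Qed.

End cutoff.

(** * Young's inequality with weights *)

Section absorption.
Context {R : realType}.

(** If X^(p-1) c^2 >= 2B, the left-hand side is at most half of X^p c^(k+3).
    Otherwise X c^(2/(p-1)) <= (2B)^(1/(p-1)), and c^(k+1) <= c^(2/(p-1)) since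
    c <= 1; the exponent of B in the remainder is then 1 + 1/(p-1) = p'. *)
Lemma young_absorb (p X B c : R) (k : nat) :
  1 < p -> 2 / (p - 1) <= k.+1%:R -> 0 <= X -> 0 < B -> 0 <= c <= 1 ->
  X * (B * c ^+ k.+1) <= 2^-1 * (X `^ p * c ^+ k.+3) + (2 * B) `^ (p - 1)^-1 * B.
Proof.
move=> p1 pk X0 B0 /andP[c0 c1].
have p10 : 0 < p - 1 by rewrite subr_gt0.
have e0 : 0 < (p - 1)^-1 by rewrite invr_gt0.
have R10 : 0 <= 2^-1 * (X `^ p * c ^+ k.+3).
  apply: mulr_ge0; first by rewrite invr_ge0.
  by apply: mulr_ge0; [exact: powR_ge0|exact: exprn_ge0].
have R20 : 0 <= (2 * B) `^ (p - 1)^-1 * B by rewrite mulr_ge0 ?powR_ge0 ?ltW.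
have [X00|Xn0] := eqVneq X 0; first by rewrite {1}X00 mul0r addr_ge0.
have [c00|cn0] := eqVneq c 0.
  by rewrite {1}c00 expr0n/= !mulr0 addr_ge0.
have Xp : 0 < X by rewrite lt_neqAle eq_sym Xn0.
have cp : 0 < c by rewrite lt_neqAle eq_sym cn0.
have ck0 : 0 <= c ^+ k.+1 by rewrite exprn_ge0.
have XE : X `^ p = X `^ (p - 1) * X.
  by rewrite -(mulr_powRB1 X0 (lt_trans ltr01 p1)) mulrC.
have [big|small] := leP (2 * B) (X `^ (p - 1) * c ^+ 2).
  apply: ler_wpDr => //; rewrite XE.
  rewrite (_ : 2^-1 * _ =
      (2^-1 * (X `^ (p - 1) * c ^+ 2)) * (X * c ^+ k.+1)); last first.
    by rewrite [in LHS](exprD c 2 k.+1 : c ^+ k.+3 = _); ring.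
  rewrite mulrCA ler_wpM2r ?mulr_ge0//; lra.
apply: ler_wpDl => //.
rewrite mulrCA [leRHS]mulrC ler_pM2l//.
have cke : c ^+ k.+1 <= c `^ (2 / (p - 1)).
  by rewrite -powR_mulrn//; apply: ger_powR; rewrite // cp.
apply: (le_trans (ler_wpM2l X0 cke)).
rewrite (_ : X * _ = (X `^ (p - 1) * c ^+ 2) `^ (p - 1)^-1); last first.
  rewrite powRM ?powR_ge0 ?exprn_ge0// -powRrM divff ?gt_eqF// powRr1//.
  by rewrite powRrM powR_mulrn.
by apply: ge0_ler_powR; rewrite ?nnegrE ?mulr_ge0 ?powR_ge0 ?exprn_ge0 ?ltW.
Qed.

End absorption.

(** * Iterated integrals *)

Section iterated_integrals.
Context {R : realType} d1 d2 (T1 : measurableType d1) (T2 : measurableType d2).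
Variables (m1 : {sigma_finite_measure set T1 -> \bar R})
          (m2 : {sigma_finite_measure set T2 -> \bar R}).
Local Open Scope ereal_scope.

Lemma iterated_integralD (I : set T1) (F G : T1 * T2 -> \bar R) :
  measurable I -> measurable_fun setT F -> measurable_fun setT G ->
  (forall z, 0 <= F z) -> (forall z, 0 <= G z) ->
  \int[m1]_(t in I) \int[m2]_x (F (t, x) + G (t, x)) =
  \int[m1]_(t in I) \int[m2]_x F (t, x) + \int[m1]_(t in I) \int[m2]_x G (t, x).
Proof.
move=> mI mF mG F0 G0.
under eq_integral => t _.
  rewrite ge0_integralD//; last 2 first.
  - exact: (measurableT_comp mF (pair1_measurable t)).
  - exact: (measurableT_comp mG (pair1_measurable t)).
  over.
rewrite ge0_integralD//.
- by move=> t _; exact: integral_ge0.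
- by apply: measurable_funTS; exact: measurable_fun_fubini_tonelli_F.
- by move=> t _; exact: integral_ge0.
- by apply: measurable_funTS; exact: measurable_fun_fubini_tonelli_F.
Qed.

Lemma iterated_integralZl (I : set T1) (F : T1 * T2 -> \bar R) (c : R) :
  measurable I -> measurable_fun setT F ->
  (forall z, 0 <= F z) -> (0 <= c)%R ->
  \int[m1]_(t in I) \int[m2]_x (c%:E * F (t, x)) =
  c%:E * \int[m1]_(t in I) \int[m2]_x F (t, x).
Proof.
move=> mI mF F0 c0.
under eq_integral => t _.
  rewrite ge0_integralZl_EFin//; last first.
    exact: (measurableT_comp mF (pair1_measurable t)).
  over.
rewrite ge0_integralZl_EFin//.
- by move=> t _; exact: integral_ge0.
- by apply: measurable_funTS; exact: measurable_fun_fubini_tonelli_F.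
Qed.

Lemma iterated_integral_indic (I J : set T1) (B : set T2) (c : R) :
  measurable I -> measurable J -> measurable B -> J `<=` I -> (0 <= c)%R ->
  \int[m1]_(t in I) \int[m2]_x (c * (\1_J t * \1_B x))%:E = c%:E * (m1 J * m2 B).
Proof.
move=> mI mJ mB JI c0.
transitivity (\int[m1]_(t in I) (c%:E * (m2 B * (\1_J t)%:E))).
  apply: eq_integral => t _; under eq_integral do rewrite EFinM EFinM.
  rewrite ge0_integralZl_EFin//; last first.
    by apply/measurable_EFinP; apply: measurable_funM.
  rewrite ge0_integralZl_EFin//; last by apply/measurable_EFinP.
  by rewrite integral_indic// setIT [(\1_J t)%:E * _]muleC.
rewrite ge0_integralZl_EFin//; last 2 first.
- by move=> t _; rewrite mule_ge0.
- by apply: measurable_funeM; apply/measurable_EFinP.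
rewrite ge0_integralZl//; last by apply/measurable_EFinP.
by rewrite integral_indic// setIidl// [m1 J * _]muleC.
Qed.

Lemma measurable_indicX (J : set T1) (B : set T2) (c : R) :
  measurable J -> measurable B ->
  measurable_fun setT (fun z : T1 * T2 => (c * (\1_J z.1 * \1_B z.2))%:E).
Proof.
move=> mJ mB; apply/measurable_EFinP; apply: measurable_funM => //.
apply: measurable_funM.
  exact: (measurableT_comp (measurable_indic mJ) measurable_fst).
exact: (measurableT_comp (measurable_indic mB) measurable_snd).
Qed.

Lemma le_iterated_integral (I : set T1) (f g : T1 -> T2 -> \bar R) :
  (forall t x, I t -> 0 <= f t x) -> (forall t x, I t -> f t x <= g t x) ->
  \int[m1]_(t in I) \int[m2]_x f t x <= \int[m1]_(t in I) \int[m2]_x g t x.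
Proof.
move=> f0 fg; apply: le_integral_ge0 => t It.
  by apply: integral_ge0 => x _; exact: f0.
by apply: le_integral_ge0 => x _; [exact: f0|exact: fg].
Qed.

Lemma oppe_iterated_integral_le (I : set T1) (f h : T1 -> T2 -> \bar R) :
  (forall t x, I t -> 0 <= h t x) -> (forall t x, I t -> - f t x <= h t x) ->
  - (\int[m1]_(t in I) \int[m2]_x f t x) <= \int[m1]_(t in I) \int[m2]_x h t x.
Proof.
move=> h0 fh; apply: oppe_integral_le => t It.
  by apply: integral_ge0 => x _; exact: h0.
by apply: oppe_integral_le => x _; [exact: h0|exact: fh].
Qed.

End iterated_integrals.

(** * What a weak solution implies for the forcing *)

Section weak_solution.
Context {R : realType} {N : nat}.
Local Notation mu := (@lebesgue_measure R).
Local Notation nu := (@lebesgue_rV R N).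

Lemma measurable_spacetime :
  measurable (@spacetime R N : set (measurableTypeR R * 'rV[R]_N)).
Proof.
rewrite (_ : @spacetime R N = fst @^-1` `[0, +oo[%classic); last first.
  by apply/seteqP; split => z /=; rewrite in_itv/= andbT.
by rewrite -[X in measurable X]setTI; exact: measurable_fst.
Qed.

(** A weak solution is only known to be measurable for t >= 0; extending it by 0
    gives a function measurable on the whole product, as Fubini requires. *)
Definition extend0 (u : R -> 'rV[R]_N -> R) :
    measurableTypeR R * 'rV[R]_N -> R :=
  (fun z => u z.1 z.2) \_ (@spacetime R N).

Lemma extend0E u t x : 0 <= t -> extend0 u (t, x) = u t x.
Proof. by move=> t0; rewrite /extend0 patchT// inE. Qed.

Lemma measurable_extend0 (p : R) (u : R -> 'rV[R]_N -> R) :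
  Lploc_spacetime p (fun t x => (u t x)%:E) -> measurable_fun setT (extend0 u).
Proof.
move=> [mu_ _]; apply/(measurable_restrictT _ measurable_spacetime).
by apply/measurable_EFinP.
Qed.

Lemma measurable_powR_extend0 (p : R) (u : R -> 'rV[R]_N -> R) :
  Lploc_spacetime p (fun t x => (u t x)%:E) ->
  measurable_fun setT (fun z => `|extend0 u z| `^ p).
Proof.
move=> /measurable_extend0 mu_.
apply: (@measurableT_comp _ _ _ _ _ _ (@powR R ^~ p)).
  exact: measurable_powR.
exact: measurableT_comp.
Qed.

(** The test function is at most 1 and supported in a compact subset of
    spacetime, on which |u|^p is integrable.  Finiteness is what allows this
    term to be cancelled between the two sides of the weak formulation. *)
Lemma cutoff_energy_fin_num (p r : R) (k : nat) (u : R -> 'rV[R]_N -> R) :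
  0 < r -> Lploc_spacetime p (fun t x => (u t x)%:E) ->
  (\int[mu]_(t in `]0%R, (r ^+ 2)%R[) \int[nu]_x
     (`|extend0 u (t, x)| `^ p * cutoff r k.+3 t x)%:E)%E \is a fin_num.
Proof.
move=> r0 Lu; have mup := measurable_powR_extend0 Lu.
rewrite ge0_fin_numE; last first.
  apply: integral_ge0 => t _; apply: integral_ge0 => x _.
  by rewrite lee_fin mulr_ge0 ?powR_ge0 ?cutoff_ge0.
have [_ Lfin] := Lu.
pose K : set (R * 'rV[R]_N) := `[0, r ^+ 2] `*` cube r.
have KS : K `<=` @spacetime R N.
  by move=> [t x] /= [/=]; rewrite in_itv/= => /andP[].
have cK : compact K.
  by apply: compact_setX; [exact: segment_compact|exact: compact_cube].
apply: le_lt_trans (Lfin K KS cK).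
have mK : measurable (K : set (measurableTypeR R * 'rV[R]_N)).
  by apply: measurableX; [exact: measurable_itv|exact: measurable_cube].
pose F : measurableTypeR R * 'rV[R]_N -> \bar R :=
  (fun z => (`|extend0 u z| `^ p)%:E) \_ K.
have mF : measurable_fun setT F.
  apply/(measurable_restrictT _ mK); apply: measurable_funTS.
  exact/measurable_EFinP.
have F0 z : (0 <= F z)%E.
  by apply: erestrict_ge0 => y _; rewrite lee_fin powR_ge0.
rewrite (_ : (\int[lebesgue_spacetime N]_(z in K) _)%E =
    (\int[lebesgue_spacetime N]_z F z)%E); last first.
  rewrite integral_mkcond; apply: eq_integral => z _.
  rewrite /F /patch; case: ifPn => // /set_mem /KS zS.
  by case: z zS => t x /= t0; rewrite extend0E.
rewrite fubini_tonelli1//.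
apply: (@le_trans _ _
    (\int[mu]_(t in `]0%R, (r ^+ 2)%R[) fubini_F nu F t)%E); last first.
  apply: integral_set_mono => // t _; exact: integral_ge0.
apply: le_iterated_integral => t x; rewrite /= in_itv/= => /andP[t0 tr].
  by rewrite lee_fin mulr_ge0 ?powR_ge0 ?cutoff_ge0.
rewrite /F /patch; case: ifPn => [_|xK].
  rewrite lee_fin ler_piMr ?powR_ge0//.
  apply: le_trans (cutoff_mono r x (ltW t0) (leq0n _)) _.
  by rewrite /cutoff /pospow expr0.
rewrite (_ : cutoff _ _ _ _ = 0) ?mulr0//; apply: cutoff_cube => // [|xc].
  exact: ltW.
by move/negP: xK; apply; rewrite inE; split => //=; rewrite in_itv/= !ltW.
Qed.

Lemma integral_initial_ge0 (u0 : 'rV[R]_N -> R) (r : R) (k : nat) :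
  L1loc u0 -> {ae nu, forall x, 0 <= u0 x} ->
  (0 <= \int[nu]_x (u0 x * cutoff r k 0 x)%:E)%E.
Proof.
move=> [mu0 _] u00.
have mc : measurable_fun setT (fun x : 'rV[R]_N => cutoff r k 0 x).
  exact: (measurableT_comp (measurable_cutoff r k)
    (pair1_measurable (0 : measurableTypeR R))).
rewrite (@ae_eq_integral _ _ _ nu setT
  (fun x => (`|u0 x| * cutoff r k 0 x)%:E))//.
- by apply: integral_ge0 => x _; rewrite lee_fin mulr_ge0 ?cutoff_ge0.
- by apply/measurable_EFinP; exact: measurable_funM.
- apply/measurable_EFinP; apply: measurable_funM => //.
  exact: measurableT_comp.
- by apply: filterS u00 => x ux _; rewrite ger0_norm.
Qed.

Lemma test_term_le (p r : R) (k : nat) (X D c t : R) (x : 'rV[R]_N) :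
  1 < p -> 2 / (p - 1) <= k.+1%:R -> 0 < r -> 0 < D -> 0 <= t ->
  `|c| <= D * cutoff r k.+1 t x ->
  `|X * c| <= 2^-1 * (`|X| `^ p * cutoff r k.+3 t x) +
     (2 * D) `^ (p - 1)^-1 * D * \1_(cube r) x.
Proof.
move=> p1 pk r0 D0 t0 cD; rewrite normrM.
have [xr|xr] := pselect (cube r x).
  rewrite indicE mem_set// mulr1; apply: le_trans (ler_wpM2l (normr_ge0 X) cD) _.
  apply: young_absorb => //.
  by rewrite le_max lexx orbT/= ge_max ler01 paraboloid_le1.
rewrite indicE memNset// mulr0 addr0 !cutoff_cube// !mulr0.
by move: cD; rewrite cutoff_cube// mulr0 normr_le0 => /eqP ->; rewrite normr0 mulr0.
Qed.

(** Let A be the integral of |u|^p phi.  The left side of the weak formulation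
    is at least A plus the mass b |J| |B| carried by the forcing; each of the two
    terms on the right is at most A/2 plus an error independent of u, by Young's
    inequality.  As A is finite it cancels. *)
Lemma weak_solution_mass_le (p r b D : R) (k : nat) (w : R -> 'rV[R]_N -> \bar R)
    (u0 : 'rV[R]_N -> R) (u : R -> 'rV[R]_N -> R)
    (J : set (measurableTypeR R)) (B : set 'rV[R]_N) :
  1 < p -> 2 / (p - 1) <= k.+1%:R -> 0 < r -> 0 <= b ->
  L1loc u0 -> {ae nu, forall x, 0 <= u0 x} ->
  global_weak_solution p w u0 u ->
  (forall t x, 0 <= t -> (0 <= w t x)%E) ->
  measurable J -> measurable B -> J `<=` `]0, r ^+ 2[%classic ->
  (forall t x, J t -> B x -> b%:E <= w t x * (cutoff r k.+3 t x)%:E)%E ->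
  D = cutoff_bound (N := N) k / r ^+ 2 ->
  (b%:E * (mu J * nu B) <=
   (2 * ((2 * D) `^ (p - 1)^-1 * D * (r ^+ 2 * (2 * r) ^+ N)))%:E)%E.
Proof.
move=> p1 pk r0 b0 Lu0 u00 [Lu _ weak] w0 mJ mB JI wb DE.
have D0 : 0 < D.
  by rewrite DE divr_gt0 ?exprn_gt0// !mulr_gt0.
set E := (2 * D) `^ (p - 1)^-1 * D.
have E0 : 0 <= E by rewrite mulr_ge0 ?powR_ge0 ?ltW.
pose I : set (measurableTypeR R) := `]0, r ^+ 2[%classic.
have mI : measurable I by exact: measurable_itv.
have muI : mu I = (r ^+ 2)%:E.
  by rewrite lebesgue_measure_itv/= lte_fin exprn_gt0// sube0.
pose F (z : measurableTypeR R * 'rV[R]_N) : \bar R :=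
  (`|extend0 u z| `^ p * cutoff r k.+3 z.1 z.2)%:E.
have mF : measurable_fun setT F.
  apply/measurable_EFinP; apply: measurable_funM; last exact: measurable_cutoff.
  exact: measurable_powR_extend0 Lu.
have F0 z : (0 <= F z)%E by rewrite lee_fin mulr_ge0 ?powR_ge0 ?cutoff_ge0.
pose G (z : measurableTypeR R * 'rV[R]_N) : \bar R :=
  (b * (\1_J z.1 * \1_B z.2))%:E.
have mG : measurable_fun setT G by exact: measurable_indicX.
have G0 z : (0 <= G z)%E by rewrite lee_fin !mulr_ge0.
pose H (z : measurableTypeR R * 'rV[R]_N) : \bar R :=
  (E * (\1_I z.1 * \1_(cube r) z.2))%:E.
have mH : measurable_fun setT H.
  by apply: measurable_indicX => //; exact: measurable_cube.
have H0 z : (0 <= H z)%E.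
  by rewrite lee_fin (mulr_ge0 E0)// mulr_ge0.
pose A := (\int[mu]_(t in I) \int[nu]_x F (t, x))%E.
have Afin : A \is a fin_num by exact: cutoff_energy_fin_num.
have half0 : (0 <= 2^-1 :> R) by rewrite invr_ge0.
have absorbE :
  (\int[mu]_(t in I) \int[nu]_x ((2^-1)%:E * F (t, x) + H (t, x)) =
    (2^-1)%:E * A + (E * (r ^+ 2 * (2 * r) ^+ N))%:E)%E.
  rewrite (@iterated_integralD _ _ _ _ _ mu nu I
    (fun z => (2^-1)%:E * F z)%E H)//.
  - rewrite iterated_integralZl//; congr (_ + _)%E.
    rewrite iterated_integral_indic//; last exact: measurable_cube.
    rewrite !EFinM; congr (_ * (_ * _))%E; first exact: muI.
    exact: lebesgue_cube (ltW r0).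
  - exact: measurable_funeM.
  - by move=> z; rewrite mule_ge0.
have half_le (c : R -> 'rV[R]_N -> R) :
    (forall t x, 0 <= t -> `|c t x| <= D * cutoff r k.+1 t x) ->
    (- (\int[mu]_(t in I) \int[nu]_x (u t x * c t x)%:E) <=
     (2^-1)%:E * A + (E * (r ^+ 2 * (2 * r) ^+ N))%:E)%E.
  move=> cD; rewrite -absorbE; apply: oppe_iterated_integral_le => t x It.
    by rewrite adde_ge0// mule_ge0.
  have /andP[t0 _] : 0 < t < r ^+ 2 by move: It; rewrite /I/= in_itv/=.
  rewrite -EFinN lee_fin.
  apply: le_trans (ler_norm _) _; rewrite normrN (extend0E _ _ (ltW t0)).
  rewrite [X in (X * \1_(cube r) _)]indicE mem_set// mul1r.
  exact: (test_term_le (u t x) p1 pk r0 D0 (ltW t0) (cD t x (ltW t0))).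
have := weak _ _ (exprn_gt0 2 r0) (test_function_cutoff k r0).
set L := (\int[_]_(t in _) \int[_]_x (_ * (_)%:E))%E => weakE.
have LE : (A + b%:E * (mu J * nu B) <= L)%E.
  have -> : (A + b%:E * (mu J * nu B) =
      \int[mu]_(t in I) \int[nu]_x (F (t, x) + G (t, x)))%E.
    rewrite (@iterated_integralD _ _ _ _ _ mu nu I F G)//; congr (_ + _)%E.
    by apply/esym; exact: iterated_integral_indic.
  apply: le_iterated_integral => t x It; first by rewrite adde_ge0.
  have /andP[t0 _] : 0 < t < r ^+ 2 by move: It; rewrite /I/= in_itv/=.
  have wtx := w0 t x (ltW t0).
  rewrite ge0_muleDl ?lee_fin ?powR_ge0//.
  rewrite /F (extend0E _ _ (ltW t0)) -EFinM leeD2l//.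
  rewrite /G !indicE /=; have [tJ|tJ] := boolP (t \in J); last first.
    by rewrite mul0r mulr0 mule_ge0 ?lee_fin ?cutoff_ge0.
  have [xB|xB] := boolP (x \in B); last first.
    by rewrite !mulr0 mule_ge0 ?lee_fin ?cutoff_ge0.
  by rewrite !mulr1; apply: wb; rewrite -inE.
have : (A + b%:E * (mu J * nu B) <=
    ((2^-1)%:E * A + (E * (r ^+ 2 * (2 * r) ^+ N))%:E)
    + ((2^-1)%:E * A + (E * (r ^+ 2 * (2 * r) ^+ N))%:E))%E.
  apply: (le_trans LE); apply: (@le_trans _ _
      (L + \int[nu]_x (u0 x * cutoff r k.+3 0 x)%:E)%E).
    by rewrite leeDl// integral_initial_ge0.
  rewrite weakE; apply: leeD; apply: half_le => t x t0.
    by rewrite DE; exact: dt_cutoff_le.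
  by rewrite DE; exact: laplacian_cutoff_le.
rewrite -(fineK Afin) -!EFinM -!EFinD.
rewrite (_ : _ + _ + _ = fine A + 2 * (E * (r ^+ 2 * (2 * r) ^+ N)));
  last by field.
by rewrite EFinD leeD2lE.
Qed.

End weak_solution.

(** * Nonexistence *)

Section nonexistence.
Context {R : realType}.

Lemma powR_unbounded (d c C : R) : 0 < d -> 0 < c ->
  forall r0, exists2 r, r0 <= r & C < c * r `^ d.
Proof.
move=> d0 c0 r0.
pose M := `|C / c| + 1.
have M0 : 0 < M by rewrite ltr_wpDl.
exists (Num.max r0 (M `^ d^-1)); first by rewrite le_max lexx.
rewrite mulrC -ltr_pdivrMr//.
apply: (@lt_le_trans _ _ M).
  by apply: le_lt_trans (ler_norm _) _; rewrite ltrDl.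
rewrite [leLHS](_ : M = (M `^ d^-1) `^ d); last by rewrite -powRrM mulVf ?gt_eqF// powRr1// ltW.
apply: ge0_ler_powR; first exact: ltW.
- by rewrite nnegrE powR_ge0.
- by rewrite nnegrE le_max orbC powR_ge0.
- by rewrite le_max lexx orbT.
Qed.

(** A power is monotone, in a direction that depends on the sign of m. *)
Lemma powR_between (a b s m : R) : 0 < a -> a <= s <= b ->
  Num.min (a `^ m) (b `^ m) <= s `^ m.
Proof.
move=> a0 /andP[as_ sb]; have s0 := lt_le_trans a0 as_.
have b0 := lt_le_trans s0 sb.
rewrite ge_min; apply/orP; have [m0|m0] := leP 0 m.
  by left; apply: ge0_ler_powR; rewrite // nnegrE ltW.
right; rewrite -[m]opprK !(powRN _ (- m)) lef_pV2 ?posrE ?powR_gt0//.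
by apply: ge0_ler_powR; rewrite ?nnegrE ?oppr_ge0 // ltW.
Qed.

(** As p' = 1 + 1/(p-1), the assumption on p says 2p' > n + sigma - 2m (when
    this quantity is at most 2 it is clear from p' > 1), so the exponent below
    exceeds 2 sigma. *)
Lemma exponent_gap (n sigma m p : R) : 0 < sigma -> 1 < p ->
  (2 < n + sigma - 2 * m ->
     p < (n + sigma - 2 * m) / (n + sigma - 2 * m - 2)) ->
  0 < 2 + 2 * (p - 1)^-1 + 2 * m + sigma - n.
Proof.
move=> s0 p1 hp; have p10 : 0 < p - 1 by rewrite subr_gt0.
have e0 : 0 < (p - 1)^-1 by rewrite invr_gt0.
have [a2|a2] := leP (n + sigma - 2 * m) 2; first lra.
move: (hp a2); rewrite ltr_pdivlMr; last lra.
move=> pa; have : (n + sigma - 2 * m - 2) < 2 * (p - 1)^-1.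
  by rewrite ltr_pdivlMr//; lra.
lra.
Qed.

Context {N : nat}.

(** Here (t + |x|^2) / r^2 <= 1/2 + 1/4. *)
Lemma cutoff_ge_quarter (r t : R) (k : nat) (x : 'rV[R]_N) : 0 < r ->
  t <= r ^+ 2 / 2 -> enorm x <= r / 2 -> 4^-1 ^+ k <= cutoff r k t x.
Proof.
move=> r0 tr; rewrite enorm_leP ?divr_ge0 ?(ltW r0)// => xr.
have q : 4^-1 <= paraboloid r t x.
  rewrite /paraboloid lerBrDr addrC -lerBrDr ler_pdivrMr ?exprn_gt0//.
  by move: xr; rewrite expr_div_n; lra.
rewrite /cutoff /pospow lerXn2r ?nnegrE ?le_max ?q ?lexx ?orbT//.
Qed.

(** Testing on the scale r turns the upper and lower bounds on the mass of the
    forcing into c1 r^d <= C2, where d is the exponent in the hypothesis and c1,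
    C2 do not depend on r; large r contradict it. *)
Lemma no_global_weak_solution (sigma m a R0 p : R) (w : R -> 'rV[R]_N -> \bar R)
    (u0 : 'rV[R]_N -> R) (u : R -> 'rV[R]_N -> R) :
  (0 < N)%N -> 0 < a -> 1 <= R0 -> 1 < p ->
  0 < 2 + 2 * (p - 1)^-1 + 2 * m + sigma - N%:R ->
  (forall t x, 0 <= t -> (0 <= w t x)%E) ->
  (forall t r x, 1 <= t -> R0 <= r -> enorm x <= r ->
     ((a * ((2 * r) `^ (N%:R - sigma))^-1 * t `^ m)%:E <= w t x)%E) ->
  L1loc u0 -> {ae lebesgue_rV N, forall x, 0 <= u0 x} ->
  ~ global_weak_solution p w u0 u.
Proof.
move=> N0 a0 R01 p1 gap w0 wa Lu0 u00 sol.
have NR : 0 < N%:R :> R by rewrite ltr0n.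
have p10 : 0 < p - 1 by rewrite subr_gt0.
set e := (p - 1)^-1 in gap.
have e0 : 0 < e by rewrite invr_gt0.
pose k := Num.Def.truncn (2 / (p - 1)).
have kp : 2 / (p - 1) <= k.+1%:R by apply/ltW/truncnS_gt.
pose D1 : R := cutoff_bound (N := N) k.
have D10 : 0 < D1 by rewrite !mulr_gt0.
(* t^m >= kap (r^2)^m whenever r^2/4 <= t <= r^2/2 *)
pose kap : R := Num.min (4^-1 `^ m) (2^-1 `^ m).
have kap0 : 0 < kap by rewrite lt_min !powR_gt0.
have [q qE q0] : exists2 q : R, q = 4^-1 ^+ k.+3 & 0 < q.
  by exists (4^-1 ^+ k.+3) => //; rewrite exprn_gt0 ?invr_gt0.
pose c1 := q * a * kap * 4^-1 * (N%:R ^+ N)^-1.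
have c10 : 0 < c1.
  by rewrite !mulr_gt0 ?invr_gt0 ?exprn_gt0.
pose C2 := 2 * ((2 * D1) `^ e * D1 * 2 ^+ N).
(* r >= 2 R0 makes r/2 an admissible radius and r^2/4 an admissible time *)
have [r rR] := powR_unbounded C2 gap c10 (2 * R0).
apply/negP; rewrite -leNgt.
have rR2 : R0 <= r / 2 by lra.
have r0 : 0 < r by lra.
have r20 : 0 < r ^+ 2 by rewrite exprn_gt0.
have r2_4 : 4 <= r ^+ 2 by nra.
pose J : set (measurableTypeR R) := `[r ^+ 2 / 4, r ^+ 2 / 2]%classic.
pose B : set 'rV[R]_N := cube (r / 2 / N%:R).
pose b := a * (r `^ (N%:R - sigma))^-1 * (kap * (r ^+ 2) `^ m) * q.
have b0 : 0 < b.
  by rewrite !mulr_gt0 ?invr_gt0 ?powR_gt0.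
have mJ : measurable J by exact: measurable_itv.
have muJ : lebesgue_measure J = (r ^+ 2 / 4)%:E.
  rewrite lebesgue_measure_itv/= lte_fin ifT; last lra.
  by rewrite -EFinB; congr EFin; lra.
have nuB : lebesgue_rV N B = ((r / N%:R) ^+ N)%:E.
  rewrite lebesgue_cube ?divr_ge0 ?(ltW r0)//; congr (_ ^+ _)%:E.
  by field; rewrite gt_eqF.
have JI : J `<=` `]0, r ^+ 2[%classic.
  by move=> t; rewrite /J/= !in_itv/= => /andP[t1 t2]; apply/andP; split; lra.
have wb t x : J t -> B x -> (b%:E <= w t x * (cutoff r k.+3 t x)%:E)%E.
  rewrite /J/= in_itv/= => /andP[t1 t2] xB.
  have xr : enorm x <= r / 2.
    by apply: (cube_sub_enorm_ball _ xB); rewrite divr_ge0 ?(ltW r0).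
  have t01 : 1 <= t by lra.
  rewrite /b EFinM; apply: lee_pmul.
  - by rewrite lee_fin !mulr_ge0 ?invr_ge0 ?powR_ge0 ?(ltW a0) ?(ltW kap0).
  - by rewrite lee_fin ltW.
  - apply: le_trans (wa t (r / 2) x t01 rR2 xr).
    rewrite lee_fin (_ : 2 * (r / 2) = r); last by field.
    apply: ler_wpM2l; first by rewrite mulr_ge0 ?invr_ge0 ?powR_ge0 ?(ltW a0).
    rewrite (_ : t = (t / r ^+ 2) * r ^+ 2); last by rewrite divfK ?gt_eqF.
    rewrite powRM ?divr_ge0 ?(ltW r20)//; last lra.
    rewrite ler_wpM2r ?powR_ge0//; apply: powR_between; first by rewrite invr_gt0.
    by rewrite ler_pdivlMr// ler_pdivrMr//; apply/andP; split; lra.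
  - by rewrite lee_fin qE; exact: cutoff_ge_quarter.
have := weak_solution_mass_le p1 kp r0 (ltW b0) Lu0 u00 sol w0 mJ
  (measurable_cube _) JI wb erefl.
rewrite muJ nuB -!EFinM lee_fin -/D1 -/e.
set P := r `^ (N%:R - sigma); set Q := (r ^+ 2) `^ m; set S := (r ^+ 2) `^ e.
have P0 : 0 < P by rewrite powR_gt0.
have Q0 : 0 < Q by rewrite powR_gt0.
have S0 : 0 < S by rewrite powR_gt0.
have rn0 : 0 < r ^+ N by rewrite exprn_gt0.
have -> : r `^ (2 + 2 * e + 2 * m + sigma - N%:R) = r ^+ 2 * S * Q / P.
  have r2E : r ^+ 2 = r `^ 2 by rewrite (powR_mulrn 2 (ltW r0)).
  rewrite /P /Q /S r2E -!powRrM -!powRN.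
  rewrite -!powRD ?(gt_eqF r0) ?implybT//.
  by congr powR; ring.
have -> : (2 * (D1 / r ^+ 2)) `^ e = (2 * D1) `^ e / S.
  rewrite mulrA powRM ?invr_ge0 ?mulr_ge0 ?(ltW D10) ?(ltW r0)//.
  by congr (_ * _); rewrite -[r ^- 2](powR_inv1 (ltW r20)) -powRrM mulN1r powRN.
rewrite expr_div_n [(2 * r) ^+ N]exprMn => main.
rewrite /C2 /c1.
have F0 : 0 < S / r ^+ N by rewrite divr_gt0.
move: main; rewrite -(ler_pM2r F0) /b -/P -/Q => main.
apply: le_trans (le_trans main _); rewrite le_eqVlt; apply/orP; left; apply/eqP.
  by field; rewrite !gt_eqF ?exprn_gt0.
by field; rewrite !gt_eqF.
Qed.

End nonexistence.

Theorem theorem8p1 (R : realType) (N : nat) (sigma m cNs : R)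
    (g : 'rV[R]_N -> R -> R) (c0 R0 : R) (w : R -> 'rV[R]_N -> \bar R)
    (hsigma : 0 < sigma < N%:R)
    (hm : -1 < m)
    (hcNs : 0 < cNs)
    (hg_meas : measurable_fun
       ([set z | 0 <= z.2] : set ('rV[R]_N * measurableTypeR R))
       (fun z => g z.1 z.2))
    (hg_ge0 : forall y t, 0 <= t -> 0 <= g y t)
    (hc0 : 0 < c0)
    (hR0 : 1 <= R0)
    (hg_mass : forall t r, 1 <= t -> R0 <= r ->
       ((c0 * t `^ m)%:E <=
        \int[lebesgue_rV N]_(y in enorm_ball r) (g y t)%:E)%E)
    (hw : w = fun t x => riesz_potential cNs sigma (fun y => g y t) x) :
  (exists2 c : R, 0 < c &
    forall T t : R, Num.max 1 (R0 ^+ 2) <= T -> 1 <= t ->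
      ((c * T `^ (sigma / 2) * t `^ m)%:E <=
       \int[lebesgue_rV N]_(x in enorm_ball (Num.sqrt T)) w t x)%E) /\
  (Lploc_spacetime 1 w ->
    forall p : R, 1 < p ->
      (2 < N%:R + sigma - 2 * m ->
        p < (N%:R + sigma - 2 * m) / (N%:R + sigma - 2 * m - 2)) ->
      forall u0 : 'rV[R]_N -> R, L1loc u0 ->
        {ae lebesgue_rV N, forall x, 0 <= u0 x} ->
        ~ exists u : R -> 'rV[R]_N -> R, global_weak_solution p w u0 u).
Proof.
split; first by rewrite hw;
  exact: (riesz_forcing_mass_ge hsigma hcNs hg_meas hg_ge0 hc0 hR0 hg_mass).
move=> _ p p1 hp u0 Lu0 u00 [u].
have /andP[s0 sN] := hsigma.
apply: (@no_global_weak_solution _ N sigma m (cNs * c0) R0) => //.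
- by rewrite -(ltr0n R) (lt_trans s0).
- exact: mulr_gt0.
- exact: exponent_gap.
- move=> t x t0; rewrite hw; apply: riesz_potential_ge0 => [|y]; first exact: ltW.
  exact: hg_ge0.
- move=> t r x t1 rR xr; rewrite hw.
  apply: le_trans (riesz_forcing_ge hsigma hcNs hg_meas hg_ge0 hR0 hg_mass t1 rR xr).
  by rewrite lee_fin le_eqVlt; apply/orP; left; apply/eqP; ring.
Qed.
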